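(* $\mathfrak q_{1\Delta}=\mathfrak{at}=\mathfrak q_2$.
   Context: A $Q$-space is a topological space in which every subset is a $G_\delta$ set. A space $X$ has a $G_\delta$-diagonal if $\Delta_X=\{(x,x):x\in X\}$ is a $G_\delta$ subset of $X^2$. $\mathfrak q_2$ is the least cardinality of a second-countable Hausdorff space that is not a $Q$-space. $\mathfrak q_{1\Delta}$ is the least cardinality of a second-countable $T_1$ space with a $G_\delta$-diagonal that is not a $Q$-space. An $\omega$-tree is a rooted tree of height $\omega$ with finite levels. A subtree of a tree is a nonempty downward closed subset; an infinite subtree is one with infinitely many nodes. A family of subtrees is almost disjoint if any two distinct members have finite intersection. $\mathfrak{at}$ is the least cardinal $\kappa$ for which there are an $\omega$-tree $T$, an almost disjoint family $\mathcal X$ of infinite subtrees of $T$ with $|\mathcal X|\leq\kappa$, and $\mathcal Y\subseteq\mathcal X$ such that there is no $D\subseteq T$ with $D\cap Y$ infinite for all $Y\in\mathcal Y$ and $D\cap Z$ finite for all $Z\in\mathcal X\setminus\mathcal Y$. *)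

(* Defs.v *)
From HB Require Import structures.
From mathcomp Require Import all_boot all_order.
From mathcomp Require Import boolp classical_sets functions cardinality wochoice.
From mathcomp Require Import topology borel_hierarchy.

Set Implicit Arguments.
Unset Strict Implicit.
Unset Printing Implicit Defensive.

Local Open Scope classical_set_scope.
Local Open Scope card_scope.

(* A cardinal is represented by a type, up to bijection: [K] is the least
   cardinal satisfying [P] when [P K] holds and [K] injects into every [L]
   satisfying [P]. *)
Definition least_cardinal (P : Type -> Prop) (K : Type) : Prop :=
  P K /\ forall L : Type, P L -> [set: K] #<= [set: L].

Definition Q_space (X : topologicalType) : Prop := forall A : set X, Gdelta A.

Definition Gdelta_diagonal (X : topologicalType) : Prop :=
  Gdelta (@diagonal X).

Definition is_q2 : Type -> Prop := least_cardinal (fun K =>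
  exists X : topologicalType,
    [/\ @second_countable X, hausdorff_space X, ~ Q_space X
      & [set: X] #= [set: K]]).

(* [accessible_space] is the T1 axiom. *)
Definition is_q1Delta : Type -> Prop := least_cardinal (fun K =>
  exists X : topologicalType,
    [/\ @second_countable X, accessible_space X, Gdelta_diagonal X,
        ~ Q_space X & [set: X] #= [set: K]]).

Section Trees.
Context {d : Order.disp_t} {T : porderType d}.

Definition predecessors (t : T) : set T := [set s | (s < t)%O].

(* A well-order on [n] elements has order type [n], so for [tree T] this is the
   set of the nodes of height [n]. *)
Definition level (n : nat) : set T := [set t | predecessors t #= `I_n].

Definition down_closed (S : set T) : Prop :=
  forall s t : T, (s <= t)%O -> S t -> S s.

Definition subtree (S : set T) : Prop := S !=set0 /\ down_closed S.

Definition almost_disjoint (F : set (set T)) : Prop :=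
  forall A B, F A -> F B -> A <> B -> finite_set (A `&` B).

End Trees.

Section OmegaTrees.
Context {d : Order.disp_t} (T : porderType d).

Definition tree : Prop :=
  forall t : T, wo_chain <=%O [pred s : T | (s < t)%O].

Definition rooted : Prop := exists r : T, forall t : T, (r <= t)%O.

(* Every node has finite height, and every finite height is attained. *)
Definition height_omega : Prop :=
  (forall t : T, exists n, level n t) /\ (forall n, @level d T n !=set0).

Definition omega_tree : Prop :=
  [/\ tree, rooted, height_omega & forall n, finite_set (@level d T n)].

End OmegaTrees.

Definition is_at : Type -> Prop := least_cardinal (fun K =>
  exists (d : Order.disp_t) (T : porderType d) (F G : set (set T)),
    [/\ omega_tree T,
        (forall S, F S -> subtree S /\ infinite_set S),
        almost_disjoint F,
        F #<= [set: K]
      & G `<=` F /\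
        ~ exists D : set T,
            (forall Y, G Y -> infinite_set (D `&` Y)) /\
            (forall Z, (F `\` G) Z -> finite_set (D `&` Z))]).

(* Main.v *)
Require Import Defs.
From HB Require Import structures.
From mathcomp Require Import all_boot all_order finmap.
From mathcomp Require Import boolp classical_sets functions cardinality wochoice.
From mathcomp Require Import topology borel_hierarchy.

(** The three cardinals agree because, for every [K], the following are
    equivalent up to passing to a smaller cardinal: some almost disjoint family
    of at most [K] subtrees cannot be separated; some second-countable Hausdorff
    space with at most [K] points is not a Q-space; some second-countable T1
    space with a G_delta diagonal and at most [K] points is not a Q-space.
    Cardinals are well-ordered ([smallest_cardinal]) and there is a family of
    trees that cannot be separated ([at_witness_exists]), so all three cardinals
    exist and are equal.

    All implications use that below each of these cardinals every family of
    functions from [nat] to [nat] is eventually dominated by one function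
    ([gaps_bounded_bounding]).  This comes from separating the eventually false
    binary sequences from given other ones, either by a set of nodes of the
    binary tree or by G_delta sets of a subspace of the Cantor space.

    From spaces to trees: let [G] be a part of an almost disjoint family [F] of
    infinite subtrees.  Replacing every member of [G] by one of its branches only
    makes it harder to meet, so a set of nodes that separates the thinned
    family separates the original one ([at_witness_thin]).  The thinned family
    is topologized in two ways.  When the trees missing a given finite set of
    nodes are basic open, the space is Hausdorff, as two trees have finitely many
    common nodes; when the trees containing a given finite set of nodes are basic
    open, the space is T1 and has a G_delta diagonal for the same reason.  If
    the space is a Q-space, a G_delta representation of [G] or of its complement
    gives basic open sets whose defining finite sets of nodes can be bounded in
    height, and on a chain a finite set of nodes can be replaced by its highest
    node.  Hence the representation turns into one set of nodes
    ([avoid_separable], [hit_separable]).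

    From trees to spaces, subtrees of the binary tree suffice.  In a Hausdorff
    space, list the pairs of disjoint basic open sets; a node of the tree of [x]
    names, for each of finitely many pairs, one member that does not contain
    [x].  Distinct points have almost disjoint trees, and a
    set separating the trees of the points outside [A] from the others yields a
    G_delta representation of [A] ([separable_hausdorff]).  In a space with a
    G_delta diagonal the nodes of [x] record neighbourhoods of [x] from a
    sequence of covers that distinguishes points
    ([separable_Gdelta_diagonal]).  Domination makes these infinite covers
    effectively finite, as is needed for trees with finite levels. *)

Set Implicit Arguments.
Unset Strict Implicit.
Unset Printing Implicit Defensive.
Import Order.TTheory.
Local Open Scope classical_set_scope.
Local Open Scope card_scope.

(** * Cardinals *)

Lemma card_le_inj (A B : Type) :
  [set: A] #<= [set: B] <-> exists f : A -> B, injective f.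
Proof.
split=> [/card_leP[f]|[f finj]].
  exists (fun a => val (f (to_setT a))) => a b /val_inj fab.
  have /(congr1 val) // : to_setT a = to_setT b.
  by apply: (@inj _ _ _ f); rewrite ?inE.
rewrite -(card_le_eql (@inj_card_eq _ _ setT f _)); first exact: card_leT.
by move=> a b _ _; exact: finj.
Qed.

(** By Zorn's lemma there is a maximal set [R] of choice functions no two of
    which agree anywhere.  Were no coordinate of [R] onto, a function avoiding
    all values taken by [R] could be added to it; and when the coordinate [i] is
    onto, following [R] from [L i] to [L j] is injective. *)
Lemma smallest_cardinal (I : Type) (L : I -> Type) : I ->
  exists i, forall j, [set: L i] #<= [set: L j].
Proof.
move=> i0.
pose P (R : set (forall i, L i)) :=
  forall f g i, R f -> R g -> f i = g i -> f = g.
have [|R [PR maxR]] := @Zorn_bigcup _ P.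
  move=> F FP totF f g i [A FA Af] [B FB Bg].
  have [AB|BA] := totF A B FA FB.
    by apply: (FP B FB) => //; exact: AB.
  by apply: (FP A FA) => //; exact: BA.
have [i onto_i] : exists i, forall y, exists2 f, R f & f i = y.
  apply: contrapT => /forallNP nonto.
  have new i : {y : L i | forall f, R f -> f i <> y}.
    apply: cid; have /existsNP[y Ny] := nonto i.
    by exists y => f Rf fy; apply: Ny; exists f.
  pose h i := sval (new i).
  have hP f i : R f -> f i <> h i by rewrite /h; case: (new i) => y /= + Rf; exact.
  apply: (maxR (R `|` [set h])).
    split=> [f|sub]; first by left.
    have /sub Rh : (R `|` [set h]) h by right.
    by case: (hP _ i0 Rh).
  move=> f g i [Rf|->] [Rg|->] // fg.
  - exact: PR fg.
  - by case: (hP _ _ Rf fg).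
  - by case: (hP _ _ Rg (esym fg)).
exists i => j; apply/card_le_inj.
have {}onto_i y := cid2 (onto_i y).
exists (fun y => s2val (onto_i y) j) => y z.
case: (onto_i y) (onto_i z) => f /= Rf <- [g /= Rg <-] fg.
by rewrite (PR _ _ _ Rf Rg fg).
Qed.

Lemma least_cardinal_exists (P : Type -> Prop) (K0 : Type) :
  (forall A B, P A -> [set: A] #<= [set: B] -> P B) -> P K0 ->
  exists K, least_cardinal P K.
Proof.
move=> Pup PK0.
have PT : P (set_type [set: K0]).
  by apply: Pup PK0 _; apply/card_le_inj; exists to_setT => a b /(congr1 val).
have [[K /= PK] Kmin] := @smallest_cardinal {A : set K0 | P (set_type A)}
  (fun A => set_type (sval A)) (exist _ [set: K0] PT).
exists (set_type K); split=> // L PL.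
have [b bmin] := @smallest_cardinal bool (fun b => if b then set_type K else L) true.
case: b bmin => [/(_ false)//|/(_ true) /= /[dup] LK].
move=> /card_le_inj[f finj].
pose B := range (fun l => val (f l)).
have ginj : injective (fun l => val (f l)) by move=> l m /val_inj/finj.
have LB : [set: L] #= B.
  by apply: card_esym; apply: inj_card_eq => l m _ _; exact: ginj.
have PB : P (set_type B).
  apply: Pup PL _; rewrite (card_le_eqr (card_setT B)).
  by rewrite (card_le_eql LB).
apply: card_le_trans (Kmin (exist _ B PB)) _ => /=.
by rewrite (card_le_eql (card_setT B)) -(card_le_eql LB).
Qed.

(** Hilbert's hotel: the points [g 0], [g 1], ... of an infinite type make room
    for countably many new ones. *)
Lemma card_addnat (A : Type) : infinite_set [set: A] ->
  [set: A + nat] #<= [set: A].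
Proof.
move=> /infiniteP/card_le_inj[g ginj]; apply/card_le_inj.
have gP a : {n | a = g n} + {forall n, a <> g n}.
  have [e|e] := pselect (exists n, a = g n); [left; exact: cid|right=> n an].
  by apply: e; exists n.
pose h (x : A + nat) := match x with
  | inl a => if gP a is inleft n then g (sval n).*2 else a
  | inr n => g n.*2.+1 end.
exists h => -[a|n] [b|m] /=.
- case: (gP a) (gP b) => [[n an]|Na] [[m bm]|Nb] //=.
  + by move=> /ginj/double_inj nm; rewrite an bm nm.
  + by move=> /esym/Nb.
  + by move=> /Na.
  + by move=> ->.
- case: (gP a) => [[k ak]|Na] /=; last by move=> /Na.
  by move=> /ginj/(congr1 odd) /=; rewrite !odd_double.
- case: (gP b) => [[k bk]|Nb] /=; last by move/esym/Nb.
  by move=> /ginj/(congr1 odd) /=; rewrite !odd_double.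
- by move=> /ginj[/double_inj ->].
Qed.

(** * Topological spaces *)

Section TopologicalSpaces.
Context {X : topologicalType}.

Lemma open_pointwise (O : set X) :
  (forall x, O x -> exists U, [/\ open U, U x & U `<=` O]) -> open O.
Proof.
move=> OP; rewrite openE => x /OP[U [Uo Ux UO]].
by rewrite /interior nbhsE; exists U.
Qed.

Lemma second_countable_basis : @second_countable X ->
  exists B : nat -> set X, (forall n, open (B n)) /\
    forall (O : set X) x, open O -> O x -> exists n, B n x /\ B n `<=` O.
Proof.
move=> [B cB [Bo Bb]].
have B_at (O : set X) x : open O -> O x -> exists U, [/\ B U, U x & U `<=` O].
  move=> Oo Ox; have [|U [BU Ux] UO] := Bb x O; last by exists U.
  exact: open_nbhs_nbhs.
have [B0|[f]] := (@pfcard_geP _ _ B [set: nat]) cB.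
  exists (fun=> set0); split=> [_|O x Oo Ox]; first exact: open0.
  by have [U []] := B_at O x Oo Ox; rewrite B0.
exists f; split=> [n|O x Oo /(B_at O x Oo)[U [BU Ux UO]]].
  exact/Bo/funS.
by have [n _ fn] : (f @` setT) U by [exact: surj]; exists n; rewrite fn.
Qed.

Lemma Gdelta_decreasing (A : set X) : Gdelta A ->
  exists F : nat -> set X, [/\ forall n, open (F n),
    forall m n, m <= n -> F n `<=` F m & forall x, A x <-> forall n, F n x].
Proof.
move=> [F Fo ->].
pose G := fix G n := if n is m.+1 then G m `&` F n else F 0.
have GF n : G n `<=` F n by case: n => //= n x [].
exists G; split.
- by elim=> [|n IH] /=; [exact: Fo|exact: openI].
- move=> m n /subnK <-; elim: (n - m) => // k IH.
  by rewrite addSn => x [/IH].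
- move=> x; split=> [Fx|Gx]; last by move=> n _; exact: GF.
  by elim=> [|n IH] /=; [exact: Fx|split=> //; exact: Fx].
Qed.

Lemma Gdelta_intro (F : nat -> set X) (A : set X) :
  (forall n, open (F n)) -> (forall x, A x <-> forall n, F n x) -> Gdelta A.
Proof.
move=> Fo AF; exists F => //; apply/seteqP; split=> [x /AF Fx n _ //|x Fx].
by apply/AF => n; exact: Fx.
Qed.

Lemma hausdorff_sep : hausdorff_space X <-> forall x y : X, x <> y ->
  exists U V : set X, [/\ open U, open V, U x, V y & forall z, U z -> ~ V z].
Proof.
rewrite open_hausdorff; split=> [sep x y /eqP/sep[[U V]]|sep x y /eqP/sep].
  rewrite /= !inE => -[Ux Vy] [Uo Vo UV]; exists U, V; split=> // z Uz Vz.
  by suff : set0 z by []; rewrite -UV.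
move=> [U [V [Uo Vo Ux Vy UV]]]; exists (U, V); rewrite /= !inE; split=> //.
by apply/seteqP; split=> // z [/UV Vz /Vz].
Qed.

Lemma accessible_sep : (forall x y : X, x <> y ->
  exists U : set X, [/\ open U, U x & ~ U y]) -> accessible_space X.
Proof.
move=> sep x y /eqP/sep[U [Uo Ux Uy]].
by exists U; rewrite !inE.
Qed.

Lemma open_square (U : set X) : open U -> open (U `*` U).
Proof.
move=> Uo; rewrite openE => -[x y] [/= Ux Uy].
by exists (U, U) => //; split; exact: open_nbhs_nbhs.
Qed.

Lemma open_square_sub (O : set (X * X)) x : open O -> O (x, x) ->
  exists U : set X, [/\ open U, U x & U `*` U `<=` O].
Proof.
rewrite openE => /[apply] -[[V W] /= [Vx Wx] VW].
have : nbhs x (V `&` W) by exact: filterI.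
rewrite nbhsE => -[U [Uo Ux] UVW]; exists U; split=> // -[y z] [/= Uy Uz].
by apply: VW; split=> /=; [case: (UVW _ Uy)|case: (UVW _ Uz)].
Qed.

End TopologicalSpaces.

(** A copy of [X], which keeps apart the topologies that different subbases [U]
    induce on one set. *)
Definition subbase_space (X I : Type) (U : I -> set X) : Type := X.

Section SubbaseSpace.
Context {X I : Type} (U : I -> set X).

Local Notation space := (subbase_space U).

Definition subbasic_box (a : set I) : set X := [set x | forall i, a i -> U i x].

Definition subbase_open (O : set space) : Prop := forall x, O x ->
  exists a, [/\ finite_set a, subbasic_box a x & subbasic_box a `<=` O].

Let subbase_openT : subbase_open setT.
Proof. by move=> x _; exists set0; split=> // i []. Qed.

Let subbase_openI : setI_closed subbase_open.
Proof.
move=> O P Oo Po x [/Oo[a [fa ax aO]] /Po[b [fb bx bP]]].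
exists (a `|` b); split=> [|i [/ax|/bx]//|y aby].
  by rewrite finite_setU.
by split; [apply: aO => i ?; apply: aby; left|apply: bP => i ?; apply: aby; right].
Qed.

Let subbase_open_bigU (J : Type) (f : J -> set space) :
  (forall j, subbase_open (f j)) -> subbase_open (\bigcup_j f j).
Proof.
move=> fo x [j _ /fo[a [fa ax af]]]; exists a; split=> // y /af fy.
by exists j.
Qed.

HB.instance Definition _ := gen_eqMixin space.
HB.instance Definition _ := gen_choiceMixin space.
HB.instance Definition _ := isOpenTopological.Build space
  subbase_openT subbase_openI subbase_open_bigU.

Lemma subbase_spaceE (O : set space) : open O <-> subbase_open O.
Proof.
split=> [|Oo].
  rewrite openE => Oo x /Oo [V [Vo Vx VO]].
  have [a [fa ax aV]] := Vo x Vx; exists a; split=> //.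
  exact: subset_trans VO.
by rewrite openE => x Ox; exists O; split.
Qed.

Lemma open_subbasic_box a : finite_set a -> @open space (subbasic_box a).
Proof. by move=> fa; apply/subbase_spaceE => x ax; exists a; split. Qed.

Lemma open_subbase i : @open space (U i).
Proof.
apply/subbase_spaceE => x Ux; exists [set i]; split=> [//|j ->//|y].
exact.
Qed.

Lemma subbase_second_countable : countable [set: I] -> @second_countable space.
Proof.
move=> cI; exists (subbasic_box @` [set a | a `<=` setT /\ finite_set a]).
  apply: sub_countable (countable_finite_subset cI).
  exact: card_image_le.
split=> [_ [a [_ fa] <-]|x O]; first exact: open_subbasic_box.
rewrite nbhsE => -[P [/subbase_spaceE Po Px] PO].
have [a [fa ax aP]] := Po x Px; exists (subbasic_box a).
  by split=> //; exists a.
exact: subset_trans PO.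
Qed.

End SubbaseSpace.

(** * Trees *)

(** The features of an omega-tree used below; they determine [ht t] as the number
    of predecessors of [t]. *)
Definition height_function d (T : porderType d) (ht : T -> nat) : Prop :=
  [/\ forall n, finite_set [set t | ht t < n]%N,
      forall s t : T, (s < t)%O -> (ht s < ht t)%N,
      forall (u : T) k, (k <= ht u)%N -> exists2 v, (v <= u)%O & ht v = k
    & forall s t u : T, (s <= u)%O -> (t <= u)%O -> (s <= t)%O \/ (t <= s)%O].

Lemma omega_tree_height d (T : porderType d) : omega_tree T ->
  exists ht : T -> nat, height_function ht.
Proof.
move=> [wo _ [lev _] finlev].
pose ht t := sval (cid (lev t)).
have htP t : predecessors t #= `I_(ht t) by rewrite /ht; case: (cid _).
pose pc (t : T) := fset_set (predecessors t).
have fin_pc (t : T) : finite_set (predecessors t) by exists (ht t).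
have card_pc (t : T) : #|` pc t|%fset = ht t by exact: card_fset_set.
have in_pc (s t : T) : (s \in pc t) = (s < t)%O.
  by rewrite in_fset_set //; apply/idP/idP; rewrite inE.
have ht_lt (s t : T) : (s < t)%O -> (ht s < ht t)%N.
  move=> st; rewrite -!card_pc; apply: fproper_ltn_card; apply/andP; split.
    by apply/fsubsetP => r; rewrite !in_pc => /lt_trans; apply.
  by apply/negP => /fsubsetP/(_ s); rewrite !in_pc ltxx => /(_ st).
have comp (s t u : T) : (s <= u)%O -> (t <= u)%O -> (s <= t)%O \/ (t <= s)%O.
  rewrite le_eqVlt => /predU1P[->|su]; first by right.
  rewrite le_eqVlt => /predU1P[->|tu]; first by left; exact: ltW.
  by apply/orP; apply: (wo_chainW (wo u)); rewrite inE.
exists ht; split=> //.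
- move=> n; apply: (@sub_finite_set _ _ (\bigcup_(i in `I_n) level i)).
    by move=> t /= tn; exists (ht t) => //; exact: htP.
  exact: bigcup_finite.
- move=> u k; rewrite leq_eqVlt => /predU1P[->|ku]; first by exists u.
  have uniq_ht : uniq (map ht (pc u)).
    rewrite map_inj_in_uniq ?fset_uniq // => s t; rewrite !in_pc => su tu st.
    have [] := comp s t u (ltW su) (ltW tu).
      by rewrite le_eqVlt => /predU1P[//|/ht_lt]; rewrite st ltnn.
    by rewrite le_eqVlt => /predU1P[//|/ht_lt]; rewrite st ltnn.
  have [||_ /(_ k)] := @uniq_min_size _ (map ht (pc u)) (iota 0 (ht u)) uniq_ht.
  - by move=> j /mapP[s]; rewrite in_pc => /ht_lt su ->; rewrite mem_iota.
  - by rewrite size_iota size_map -card_pc.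
  rewrite mem_iota /= ku => /mapP[v]; rewrite in_pc => vu kv.
  by exists v => //; exact: ltW.
Qed.

Section Heights.
Context {d : Order.disp_t} {T : porderType d} (ht : T -> nat).
Hypothesis htP : height_function ht.

Lemma finite_heightP (S : set T) :
  finite_set S <-> exists n, forall t, S t -> (ht t < n)%N.
Proof.
have [fin _ _ _] := htP; split=> [/finite_fsetP[X SX]|[n Sn]]; last first.
  exact: sub_finite_set (fin n).
exists (\max_(t <- X) ht t).+1 => t; rewrite SX /= => tX.
by rewrite ltnS; exact: leq_bigmax_seq.
Qed.

Lemma infinite_heightP (S : set T) :
  infinite_set S <-> forall n, exists2 t, S t & (n <= ht t)%N.
Proof.
rewrite finite_heightP; split=> [Sinf n|Sinf [n Sn]].
  apply: contrapT => /forall2NP Sn; apply: Sinf; exists n => t St.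
  by rewrite ltnNge; apply/negP; have [|] := Sn t.
by have [t /Sn tn] := Sinf n; rewrite leqNgt tn.
Qed.

Lemma height_le (s t : T) : (s <= t)%O -> (ht s <= ht t)%N.
Proof.
have [_ ht_lt _ _] := htP.
by rewrite le_eqVlt => /predU1P[->//|/ht_lt/ltnW].
Qed.

Lemma height_le_mono (s t u : T) :
  (s <= u)%O -> (t <= u)%O -> (ht s <= ht t)%N -> (s <= t)%O.
Proof.
have [_ ht_lt _ comp] := htP => su tu st; have [//|] := comp s t u su tu.
by rewrite le_eqVlt => /predU1P[->//|/ht_lt]; rewrite ltnNge st.
Qed.

Lemma countable_nodes : countable [set: T].
Proof.
have [fin _ _ _] := htP.
have -> : [set: T] = \bigcup_n [set t | ht t < n]%N.
  by apply/seteqP; split=> // t _; exists (ht t).+1 => /=.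
by apply: bigcup_countable => // n _; exact: finite_set_countable.
Qed.

Definition branch (B : set T) : Prop :=
  [/\ down_closed B, infinite_set B &
      forall s t, B s -> B t -> (ht s <= ht t)%N -> (s <= t)%O].

(** Koenig's lemma: a node with infinitely many nodes of [S] above it has, among
    its finitely many immediate successors, one with the same property. *)
Lemma koenig (S : set T) : subtree S -> infinite_set S ->
  exists2 B, branch B & B `<=` S.
Proof.
have [fin ht_lt pred _] := htP => -[_ Sdc] Sinf.
pose up t := S `&` [set u | (t <= u)%O].
pose big t := infinite_set (up t).
have bigS t : big t -> S t by move=> /infinite_setN0[u [Su tu]]; exact: Sdc Su.
have finite_step (P : set T) n : P `<=` S -> infinite_set P ->
    exists v, [/\ ht v = n, big v & infinite_set (up v `&` P)].
  move=> PS Pinf; apply: contrapT => /forallNP none; apply: Pinf.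
  apply: (@sub_finite_set _ _ ([set u | ht u < n]%N `|`
    \bigcup_(v in [set v | ht v < n.+1]%N `&` [set v | ht v = n]) (up v `&` P))).
    move=> u Pu; have [un|nu] := ltnP (ht u) n; first by left.
    have [v vu vn] := pred u n nu; right; exists v; first by rewrite /= vn.
    by split=> //; split=> //; exact: PS.
  rewrite finite_setU; split=> //; apply: bigcup_finite.
    exact: finite_setIl.
  move=> v [_ vn]; apply: contrapT => vinf; apply: (none v); split=> //.
  by apply: sub_infinite_set vinf => u [].
have step t : {v | big t -> [/\ ht v = (ht t).+1, (t <= v)%O & big v]}.
  apply: cid; have [bt|] := pselect (big t); last by exists t.
  have [|v [vt bv /infinite_setN0[u [[Su vu] [_ tu]]]]] :=
    finite_step (up t) (ht t).+1 _ bt; first by move=> u [].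
  exists v => _; split=> //; apply: (@height_le_mono _ _ u) => //.
  by rewrite vt.
have [r [hr br _]] := finite_step S 0 (@subset_refl _ S) Sinf.
pose b n := iter n (fun t => sval (step t)) r.
have bS n : b n.+1 = sval (step (b n)) by [].
have bP n : big (b n) /\ ht (b n) = n.
  elim: n => // n [bn hn]; rewrite bS; case: (step (b n)) => v /= vP.
  by have [-> _ bv] := vP bn; rewrite hn.
have ble m n : (m <= n)%N -> (b m <= b n)%O.
  move=> /subnK <-; elim: (n - m)%N => // k IH; rewrite addSn.
  apply: le_trans IH _; rewrite bS; case: (step _) => v /= vP.
  by have [] := vP (bP _).1.
exists [set t | exists n, (t <= b n)%O]; last first.
  by move=> t [n tb]; exact: Sdc tb (bigS _ (bP n).1).
split.
- by move=> s t st [n tn]; exists n; exact: le_trans tn.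
- apply/infinite_heightP => n; exists (b n); first by exists n.
  by rewrite (bP n).2.
- move=> s t [m sm] [n tn]; apply: (@height_le_mono _ _ (b (maxn m n))).
    by apply: le_trans sm (ble _ _ _); rewrite leq_maxl.
  by apply: le_trans tn (ble _ _ _); rewrite leq_maxr.
Qed.

End Heights.

(** * The binary tree *)

Definition binary : Type := seq bool.

Fact binary_display : Order.disp_t. Proof. exact: Order.Disp tt tt. Qed.

Lemma prefix_anti : antisymmetric (@prefix bool).
Proof.
move=> s t /andP[]; rewrite !prefixE => /eqP st /eqP ts.
have [sz|/ltnW sz] := leqP (size t) (size s).
  by rewrite -st take_oversize.
by rewrite -ts take_oversize.
Qed.

HB.instance Definition _ := Countable.on binary.
HB.instance Definition _ := Order.Le_isPOrder.Build binary_display binary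
  (@prefix_refl bool) prefix_anti (@prefix_trans bool).

Lemma prefix_common (T : eqType) (s t u : seq T) :
  prefix s u -> prefix t u -> size s <= size t -> prefix s t.
Proof.
rewrite !prefixE => /eqP su /eqP tu st.
by rewrite -{1}tu take_takel // su.
Qed.

Lemma binary_lt (s t : binary) : (s < t)%O = prefix s t && (size s < size t).
Proof.
have leE : (s <= t)%O = prefix s t by [].
rewrite lt_neqAle leE andbC; have [pst /=|//] := boolP (prefix s t).
apply/idP/idP => [|st]; last by apply: contraTneq st => ->; rewrite ltnn.
rewrite ltn_neqAle size_prefix // andbT; apply: contra_neqN => /eqP sz.
by move: pst; rewrite prefixE sz take_size => /eqP.
Qed.

Lemma binary_predecessors (t : binary) : predecessors t #= `I_(size t).
Proof.
apply/card_set_bijP; exists size; split.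
- by move=> s; rewrite /predecessors /= binary_lt => /andP[].
- move=> s r; rewrite !inE /predecessors /= !binary_lt.
  by move=> /andP[+ _] /andP[+ _] sz; rewrite !prefixE sz => /eqP <- /eqP ->.
- move=> n /= nt; exists (take n t); last by rewrite size_takel // ltnW.
  by rewrite /predecessors /= binary_lt prefix_take size_takel // ltnW.
Qed.

Lemma binary_level n (t : binary) : level n t <-> size t = n.
Proof.
split=> [|<-]; last exact: binary_predecessors.
rewrite /level /= => tn; apply/card_eq_II.
by rewrite -(card_eql (binary_predecessors t)).
Qed.

Lemma finite_binary_level n : finite_set [set t : binary | size t = n].
Proof.
apply: (@sub_finite_set _ _ (@tval n bool @` setT)).
  by move=> t /= /eqP tn; exists (Tuple tn).
exact: finite_image.
Qed.

Lemma omega_tree_binary : omega_tree binary.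
Proof.
split.
- move=> t; apply: antisymmetric_wo_chain => [s r _ _|A At [s0 As0]].
    exact: le_anti.
  have : exists n, `[< exists2 s : binary, s \in A & size s = n >].
    by exists (size s0); apply/asboolP; exists s0.
  case/ex_minnP => n /asboolP[s As sn] n_min; exists s; split=> // r Ar.
  have /= st := At s As; have /= rt := At r Ar.
  apply: (prefix_common (ltW st) (ltW rt)); rewrite sn.
  by apply: n_min; apply/asboolP; exists r.
- by exists ([::] : binary) => t; exact: prefix0s.
- split=> [t|n]; first by exists (size t); apply/binary_level.
  by exists (nseq n true : binary); apply/binary_level; rewrite size_nseq.
- move=> n; apply: sub_finite_set (finite_binary_level n) => t.
  by move/binary_level.
Qed.

Lemma binary_height : height_function (size : binary -> nat).
Proof.
split.
- move=> n; apply: (@sub_finite_set _ _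
    (\bigcup_(i in `I_n) [set t : binary | size t = i])).
    by move=> t /= tn; exists (size t).
  by apply: bigcup_finite => // i _; exact: finite_binary_level.
- by move=> s t; rewrite binary_lt => /andP[].
- by move=> u k ku; exists (take k u); [exact: prefix_take|rewrite size_takel].
- move=> s t u su tu; have [st|/ltnW ts] := leqP (size s) (size t).
    by left; exact: prefix_common su tu st.
  by right; exact: prefix_common tu su ts.
Qed.

(** * Separating almost disjoint families *)

Definition at_witness (K : Type) : Prop :=
  exists (d : Order.disp_t) (T : porderType d) (F G : set (set T)),
    [/\ omega_tree T,
        (forall S, F S -> subtree S /\ infinite_set S),
        almost_disjoint F,
        F #<= [set: K]
      & G `<=` F /\
        ~ exists D : set T,
            (forall Y, G Y -> infinite_set (D `&` Y)) /\
            (forall Z, (F `\` G) Z -> finite_set (D `&` Z))].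

Definition separates (I : Type) (S : I -> set binary) (A : set I)
    (D : set binary) : Prop :=
  (forall i, A i -> forall n, exists s, [/\ D s, S i s & n <= size s]) /\
  (forall i, ~ A i -> exists n, forall s, D s -> S i s -> size s < n).

(** Families of subtrees of [binary] only; infinite and finite sets of nodes are
    those with unbounded and bounded lengths. *)
Definition separable (K : Type) : Prop :=
  forall (I : Type) (S : I -> set binary) (A : set I), [set: I] #<= [set: K] ->
    (forall i s t, prefix s t -> S i t -> S i s) ->
    (forall i n, exists2 s, S i s & n <= size s) ->
    (forall i j, i <> j -> exists n, forall s, S i s -> S j s -> size s < n) ->
  exists D, separates S A D.

Lemma at_witness_card_le (K L : Type) :
  at_witness K -> [set: K] #<= [set: L] -> at_witness L.
Proof.
move=> [d [T [F [G [oT sF adF FK GF]]]]] KL; exists d, T, F, G; split=> //.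
exact: card_le_trans KL.
Qed.

Lemma not_at_witness (K : Type) : ~ at_witness K -> separable K.
Proof.
move=> NK I S A IK Sdc Sinf Sad; apply: contrapT => NS; apply: NK.
have S_inf i : infinite_set (S i) by apply/(infinite_heightP binary_height).
have S_neq i j : i <> j -> S i <> S j.
  move=> ij Sij; apply: (S_inf i); apply/(finite_heightP binary_height).
  have [n Sn] := Sad i j ij; exists n => s Ss.
  by apply: Sn => //; rewrite -Sij.
exists binary_display, binary, (range S), (S @` A); split.
- exact: omega_tree_binary.
- move=> _ [i _ <-]; split=> //; split; first exact: infinite_setN0.
  by move=> s t; exact: Sdc.
- move=> _ _ [i _ <-] [j _ <-] Sij; apply/(finite_heightP binary_height).
  have [|n Sn] := Sad i j; first by move=> ij; rewrite ij in Sij.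
  by exists n => s [Sis Sjs]; exact: Sn.
- exact: card_le_trans (card_image_le _ _) IK.
split=> [_ [i _ <-]|[D [DA DNA]]]; first by exists i.
apply: NS; exists D; split=> i Ai.
  have /(infinite_heightP binary_height) DS : infinite_set (D `&` S i).
    by apply: DA; exists i.
  by move=> n; have [s [Ds Ss] ns] := DS n; exists s.
have /(finite_heightP binary_height)[n Dn] : finite_set (D `&` S i).
  apply: DNA; split; first by exists i.
  move=> [j Aj Sji]; have [ji|/S_neq] := pselect (j = i); last exact.
  by apply: Ai; rewrite -ji.
by exists n => s Ds Ss; exact: Dn.
Qed.

(** * Points of the Cantor space *)

Definition initial (c : nat -> bool) (s : seq bool) : Prop := s = mkseq c (size s).

Lemma initial_mkseq c n : initial c (mkseq c n).
Proof. by rewrite /initial size_mkseq. Qed.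

Lemma initial_nth c s : initial c s <-> forall k, k < size s -> c k = nth false s k.
Proof.
split=> [cs k ks|cs]; first by rewrite cs nth_mkseq.
apply: (@eq_from_nth _ false) => [|j js]; first by rewrite size_mkseq.
by rewrite nth_mkseq // cs.
Qed.

Lemma initial_prefix c s t : prefix s t -> initial c t -> initial c s.
Proof.
move=> /prefixP[r ->] /initial_nth ct; apply/initial_nth => k ks.
by rewrite ct ?nth_cat ?ks // size_cat ltn_addr.
Qed.

Lemma initial_apart c e : c <> e ->
  exists n, forall s, initial c s -> initial e s -> size s <= n.
Proof.
move=> ce; have /existsNP[n cen] : ~ c =1 e by move=> /funext.
exists n => s /initial_nth cs /initial_nth es; rewrite leqNgt; apply/negP => ns.
by apply: cen; rewrite cs ?es.
Qed.

(** The binary sequences themselves form a family that is too large: coding the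
    sets [D] of nodes by branches, the branches that meet the set which they
    code in finitely many nodes are not separated from the others. *)
Lemma at_witness_exists : exists K, at_witness K.
Proof.
exists (nat -> bool); apply: contrapT => /not_at_witness sep.
pose code (D : set binary) (n : nat) :=
    `[< exists2 s : binary, D s & choice.pickle s = n >].
have code_inj : injective code.
  suff sub D E : code D = code E -> D `<=` E.
    by move=> D E DE; apply/seteqP; split; apply: sub.
  move=> DE s Ds; have : code D (choice.pickle s) by apply/asboolP; exists s.
  by rewrite DE => /asboolP[t Et /(pcan_inj choice.pickleK) <-].
pose big D := forall n, exists s, [/\ D s, initial (code D) s & n <= size s].
pose A := [set c | exists D, c = code D /\ ~ big D].
have [|||D [DA DNA]] := sep _ initial A (card_lexx _).
- by move=> c s t st; exact: initial_prefix st.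
- move=> c n; exists (mkseq c n); first exact: initial_mkseq.
  by rewrite size_mkseq.
- move=> c e /initial_apart[n cen]; exists n.+1 => s cs es.
  exact: cen.
have [AD|NAD] := pselect (A (code D)).
  have [E [/code_inj <-]] := AD.
  by apply=> n; exact: DA.
apply: (NAD); exists D; split=> // Dbig; have [n Dn] := DNA _ NAD.
by have [s [Ds /(Dn s Ds) sn]] := Dbig n; rewrite leqNgt sn.
Qed.

(** * Bounding families of functions *)

Definition bounding (K : Type) : Prop :=
  forall (I : Type) (f : I -> nat -> nat), [set: I] #<= [set: K] ->
    exists g : nat -> nat, forall i, exists m, forall n, m <= n -> f i n <= g n.

(** Below the initial segment [s], the next value [true] of [c i] comes after
    fewer than [g s] values [false].  The summand [nat] leaves room for adding the
    eventually false sequences to the family. *)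
Definition gaps_bounded (K : Type) : Prop :=
  forall (I : Type) (c : I -> nat -> bool), [set: I + nat] #<= [set: K] ->
    (forall i n, exists2 k, n <= k & c i k) ->
  exists g : seq bool -> nat, forall i, exists m, forall n, m <= n ->
    let s := mkseq (c i) n in ~ initial (c i) (s ++ nseq (g s) false).

Lemma countable_bounding (I : Type) (f : I -> nat -> nat) : countable [set: I] ->
  exists g : nat -> nat, forall i, exists m, forall n, m <= n -> f i n <= g n.
Proof.
move=> /card_le_inj[e einj].
have F m : {h : nat -> nat | forall i, e i = m -> h = f i}.
  apply: cid; have [[i <-]|Nm] := pselect (exists i, e i = m).
    by exists (f i) => j /einj ->.
  by exists id => i im; case: Nm; exists i.
exists (fun n => \max_(m < n.+1) sval (F m) n) => i; exists (e i) => n ein.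
have := @leq_bigmax _ (fun m : 'I_n.+1 => sval (F m) n) (Ordinal (ein : e i < n.+1)).
by case: (F _) => h /= /(_ i erefl) ->.
Qed.

Lemma not_initial_pad c n k : ~ initial c (mkseq c n ++ nseq k false) ->
  exists l, [/\ n <= l, l < n + k & c l].
Proof.
move=> Nc; apply: contrapT => none; apply: Nc; apply/initial_nth => l.
rewrite size_cat size_mkseq size_nseq nth_cat size_mkseq => lnk.
have [ln|nl] := ltnP l n; first by rewrite nth_mkseq.
rewrite nth_nseq if_same; apply/negP => cl; apply: none.
by exists l.
Qed.

(** With [G] bounding the gaps in the range of [F], the value [F (k + 1)] is at
    most [H (F k)] for one increasing [H], so that [F] is eventually below
    [n |-> H^n n]. *)
Lemma gaps_dominate (G : nat -> nat) : exists h : nat -> nat,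
  forall F : nat -> nat, (forall n, F n < F n.+1) ->
    (exists m, forall n, m <= n -> exists k, n <= F k < n + G n) ->
  exists m, forall n, m <= n -> F n <= h n.
Proof.
pose H n := n.+1 + \sum_(j < n.+2) G j.
have H_gt n : n < H n by rewrite /H addSn ltnS leq_addr.
have H_mono : {homo H : m n / m <= n}.
  apply: homo_leq => [//|n m p|n]; first exact: leq_trans.
  by rewrite /H [in leqRHS]big_ord_recr /= leq_add // leq_addr.
have iter_ge j n : n <= iter j H n.
  by elim: j => //= j IH; exact: leq_trans (ltnW (H_gt _)).
have iter_mono i j m n : i <= j -> m <= n -> iter i H m <= iter j H n.
  move=> ij mn; rewrite -(subnKC ij) iterD.
  elim: i {ij} (j - i) => [|i IH] k /=; last exact: H_mono.
  exact: leq_trans (iter_ge _ _).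
exists (fun n => iter n H n) => F F_lt [m gap].
have F_homo : {homo F : j k / j < k}.
  by apply: homo_ltn => // n j k; exact: ltn_trans.
have F_ge n : n <= F n by elim: n => // n IH; exact: leq_ltn_trans (F_lt n).
have F_step n : m <= n -> F n.+1 <= H (F n).
  move=> mn; have mF : m <= (F n).+1 by rewrite ltnW // ltnS (leq_trans mn).
  have [k /andP[Fk kF]] := gap _ mF.
  have nk : n < k.
    rewrite ltnNge leq_eqVlt; apply/negP => /predU1P[kn|/F_homo kn].
      by rewrite kn ltnn in Fk.
    by move: (ltn_trans kn Fk); rewrite ltnn.
  have /leq_trans : F n.+1 <= F k.
    by move: nk; rewrite leq_eqVlt => /predU1P[->//|/F_homo/ltnW].
  apply; rewrite (leq_trans (ltnW kF)) // /H leq_add2l big_ord_recr /=.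
  by rewrite leq_addl.
have F_iter j : F (m + j) <= iter j H (F m).
  elim: j => [|j IH]; first by rewrite addn0.
  by rewrite addnS /=; apply: leq_trans (F_step _ _) (H_mono _ _ IH); rewrite leq_addr.
exists (maxn m (F m)) => n; rewrite geq_max => /andP[mn Fn].
rewrite -{1}(subnKC mn); apply: leq_trans (F_iter _) _.
by apply: iter_mono => //; exact: leq_subr.
Qed.

(** Apply the bound on gaps to the ranges of the partial sums of the given
    functions; only finitely many initial segments have a given length.
    Finite families are treated apart because [I + nat] is larger than [I] when
    [I] is finite. *)
Lemma gaps_bounded_bounding (K : Type) : gaps_bounded K -> bounding K.
Proof.
move=> gaps I f IK.
have [finI|infI] := pselect (finite_set [set: I]).
  exact/countable_bounding/finite_set_countable.
pose F i n := \sum_(j < n.+1) (f i j).+1.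
have F_lt i n : F i n < F i n.+1.
  by rewrite /F [in ltnRHS]big_ord_recr /= addnS ltnS leq_addr.
have F_ge i n : n <= F i n by elim: n => // n IH; exact: leq_ltn_trans (F_lt i n).
pose c i n := `[< exists k, F i k = n >].
have [||g gP] := gaps I c.
- exact: card_le_trans (card_addnat infI) IK.
- by move=> i n; exists (F i n) => //; apply/asboolP; exists n.
have [h hP] := gaps_dominate (fun n => \max_(t : n.-tuple bool) g t).
exists h => i; have [|m Fh] := hP (F i) (F_lt i).
  have [m mP] := gP i; exists m => n /mP/not_initial_pad[l [nl lg /asboolP[k Fk]]].
  exists k; rewrite Fk nl (leq_trans lg) // leq_add2l.
  have sz : size (mkseq (c i) n) == n by rewrite size_mkseq.
  exact: (@leq_bigmax _ (fun t : n.-tuple bool => g t) (Tuple sz)).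
exists m => n /Fh; apply: leq_trans.
by rewrite /F big_ord_recr /= (leq_trans (leqnSn _)) // leq_addl.
Qed.

(** * Families of points of the Cantor space *)

Section AddedPoints.
Context {I : Type} (c : I -> nat -> bool).
Hypothesis c_inf : forall i n, exists2 k, n <= k & c i k.

(** The second summand enumerates the eventually false sequences. *)
Definition added_points (x : I + nat) : nat -> bool :=
  match x with
  | inl i => c i
  | inr n => nth false (odflt [::] (choice.unpickle n))
  end.

Definition point_set : Type := set_type (range added_points).

Definition point (z : point_set) : nat -> bool := val z.

Lemma point_inj : injective point. Proof. exact: val_inj. Qed.

Lemma card_point_set (K : Type) :
  [set: I + nat] #<= [set: K] -> [set: point_set] #<= [set: K].
Proof.
move=> IK; rewrite (card_le_eql (card_setT _)).
exact: card_le_trans (card_image_le _ _) IK.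
Qed.

Definition family_point (i : I) : point_set :=
  SigSub (mem_set (imageT added_points (inl i))).

Definition finite_point (s : seq bool) : point_set :=
  SigSub (mem_set (imageT added_points (inr (choice.pickle s)))).

Lemma finite_pointE s : point (finite_point s) = nth false s.
Proof.
rewrite -[LHS]/(added_points (inr (choice.pickle s))) /added_points.
by rewrite choice.pickleK.
Qed.

Definition eventually_false : set point_set :=
  [set z | exists m, forall n, m <= n -> ~~ point z n].

Lemma finite_point_false s : eventually_false (finite_point s).
Proof.
by exists (size s) => n sn; rewrite finite_pointE nth_default.
Qed.

Lemma family_point_false i : ~ eventually_false (family_point i).
Proof. by move=> [m mP]; have [k /mP/negP] := c_inf i m. Qed.

Lemma initial_finite_point s t : initial (point (finite_point s)) t ->
  size s <= size t -> t = s ++ nseq (size t - size s) false.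
Proof.
rewrite finite_pointE => /initial_nth st szst.
apply: (@eq_from_nth _ false) => [|j jt].
  by rewrite size_cat size_nseq subnKC.
rewrite -st // nth_cat nth_nseq if_same; case: ltnP => // js.
by rewrite nth_default.
Qed.

End AddedPoints.

(** A set [D] separating the eventually false sequences from the [c i] contains,
    for every [s], some [s ++ 0 ... 0]; take its number of zeros for [g s]. *)
Lemma separable_gaps (K : Type) : separable K -> gaps_bounded K.
Proof.
move=> sep I c IK c_inf.
have [|||D [DA DNA]] := sep (point_set c) (fun z => initial (point z))
    (@eventually_false _ c) (card_point_set c IK).
- by move=> z s t st; exact: initial_prefix st.
- move=> z n; exists (mkseq (point z) n); first exact: initial_mkseq.
  by rewrite size_mkseq.
- move=> z y zy; have [|n nP] := @initial_apart (point z) (point y).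
    by move=> /point_inj.
  by exists n.+1 => s zs ys; exact: nP.
have /choice[g gP] : forall s : seq bool, exists k, D (s ++ nseq k false).
  move=> s; have [t [Dt st szst]] := DA _ (finite_point_false c s) (size s).
  by exists (size t - size s); rewrite -(initial_finite_point st szst).
exists g => i; have [m mP] := DNA _ (@family_point_false _ _ c_inf i).
exists m => n mn /= ini; have := mP _ (gP _) ini.
by rewrite size_cat size_mkseq ltnNge (leq_trans mn) // leq_addr.
Qed.

Section CantorSubspace.
Context {Z : Type} (pt : Z -> nat -> bool).
Hypothesis pt_inj : injective pt.

Definition cylinder (s : seq bool) : set Z := [set z | initial (pt z) s].

Local Notation space := (subbase_space cylinder).

Lemma cantor_second_countable : @second_countable space.
Proof. exact: subbase_second_countable. Qed.

Lemma cantor_separation (x y : Z) : x <> y ->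
  exists n, forall s, initial (pt x) s -> initial (pt y) s -> size s <= n.
Proof. by move=> xy; apply: initial_apart => /pt_inj. Qed.

Lemma cantor_hausdorff : hausdorff_space space.
Proof.
apply/hausdorff_sep => x y /cantor_separation[n xyn].
exists (cylinder (mkseq (pt x) n.+1)), (cylinder (mkseq (pt y) n.+1)).
split; [exact: open_subbase|exact: open_subbase|exact: initial_mkseq
  |exact: initial_mkseq|].
move=> z xz yz; suff : n.+1 <= n by rewrite ltnn.
have e : mkseq (pt x) n.+1 = mkseq (pt y) n.+1 by rewrite xz yz !size_mkseq.
rewrite -{1}(size_mkseq (pt x) n.+1); apply: xyn; first exact: initial_mkseq.
by rewrite e; exact: initial_mkseq.
Qed.

Lemma cantor_Gdelta_diagonal : Gdelta_diagonal space.
Proof.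
apply: (@Gdelta_intro (space * space)%type
    (fun n => \bigcup_(s in [set s | size s = n]) (cylinder s `*` cylinder s))).
  by move=> n; apply: bigcup_open => s _; apply: open_square; exact: open_subbase.
move=> [x y]; split=> [xy n|xyn].
  exists (mkseq (pt x) n); first by rewrite /= size_mkseq.
  have {}xy : x = y := xy.
  by rewrite -xy; split; exact: initial_mkseq.
apply: contrapT => /cantor_separation[n nP].
have [s /= sn [xs ys]] := xyn n.+1.
by have := nP s xs ys; rewrite sn ltnn.
Qed.

End CantorSubspace.

(** The open sets [F n] whose intersection is the set of the eventually false
    sequences provide, for every [s], a cylinder [s ++ 0 ... 0] inside
    [F (size s)]. *)
Lemma Q_space_gaps (K : Type) :
  (forall (Z : Type) (pt : Z -> nat -> bool), injective pt ->
     [set: Z] #<= [set: K] -> Q_space (subbase_space (cylinder pt))) ->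
  gaps_bounded K.
Proof.
move=> Qs I c IK c_inf; set Z := point_set c.
have := Qs Z _ (@point_inj _ c) (card_point_set c IK) (@eventually_false _ c).
move=> /Gdelta_decreasing[F [Fo F_decr FE]].
have /choice[g gP] : forall s : seq bool, exists k, forall z : Z,
    initial (point z) (s ++ nseq k false) -> F (size s) z.
  move=> s; have /FE/(_ (size s)) := finite_point_false c s.
  have /subbase_spaceE/[apply] := Fo (size s).
  move=> [a [/finite_seqP[l la] sa aF]]; exists (\max_(t <- l) size t) => z zs.
  apply: aF => t at_; apply/initial_nth => j jt.
  have tl : size t <= \max_(t <- l) size t.
    by apply: leq_bigmax_seq => //; rewrite la in at_.
  move/initial_nth: (sa t at_) => /(_ j jt) <-.
  move/initial_nth: zs => ->; last first.
    by rewrite size_cat size_nseq (leq_trans jt) // (leq_trans tl) // leq_addl.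
  rewrite finite_pointE nth_cat nth_nseq if_same; case: ltnP => // js.
  by rewrite nth_default.
exists g => i; have /(contra_not (FE _).2) : ~ eventually_false (family_point c i).
  exact: family_point_false.
move=> /existsNP[m NFm]; exists m => n mn /= ini.
have := gP _ (family_point c i) ini; rewrite size_mkseq => /(F_decr _ _ mn).
exact: NFm.
Qed.

(** * From spaces to trees *)

Lemma leq_bigmax_lt (f : nat -> nat) m k : k < m -> f k <= \max_(j < m) f j.
Proof. by move=> km; exact: (@leq_bigmax _ (fun j : 'I_m => f j) (Ordinal km)). Qed.

Section NodeSpaces.
Context {d : Order.disp_t} {T : porderType d} (ht : T -> nat).
Hypothesis htP : height_function ht.
Context {I : Type} (N : I -> set T) (G : set I).
Hypothesis N_dc : forall i, down_closed (N i).
Hypothesis N_inf : forall i, infinite_set (N i).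
Hypothesis N_ad : forall i j, i <> j -> finite_set (N i `&` N j).
Hypothesis N_branch : forall i, G i -> branch ht (N i).
Hypothesis bound : forall f : I -> nat -> nat,
  exists g : nat -> nat, forall i, exists m, forall n, m <= n -> f i n <= g n.

Definition hit (t : T) : set I := [set i | N i t].
Definition avoid (t : T) : set I := [set i | ~ N i t].

Lemma N_node i n : exists2 t, N i t & ht t = n.
Proof.
have [_ _ pred _] := htP.
have /(infinite_heightP htP)/(_ n)[u Nu nu] := @N_inf i.
have [v vu vn] := pred u n nu; exists v => //.
exact: N_dc Nu.
Qed.

Lemma avoid_second_countable : @second_countable (subbase_space avoid).
Proof. exact/subbase_second_countable/(countable_nodes htP). Qed.

Lemma hit_second_countable : @second_countable (subbase_space hit).
Proof. exact/subbase_second_countable/(countable_nodes htP). Qed.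

(** Above the finitely many common nodes of [N i] and [N j], there is a level on
    which a subtree cannot be contained in both. *)
Lemma avoid_hausdorff : hausdorff_space (subbase_space avoid).
Proof.
apply/hausdorff_sep => i j /N_ad/(finite_heightP htP)[n ijn].
pose off k := [set t | ht t = n /\ ~ N k t].
have fin_off k : finite_set (off k).
  by apply/(finite_heightP htP); exists n.+1 => t [->].
exists (subbasic_box avoid (off i)), (subbasic_box avoid (off j)); split.
- exact: open_subbasic_box.
- exact: open_subbasic_box.
- by move=> t [].
- by move=> t [].
move=> k ki kj; have [t Nt tn] := N_node k n.
have Nit : N i t by apply: contrapT => Nit; exact: (ki t).
have Njt : N j t by apply: contrapT => Njt; exact: (kj t).
by have := ijn t (conj Nit Njt); rewrite tn ltnn.
Qed.

Lemma hit_accessible : accessible_space (subbase_space hit).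
Proof.
apply: accessible_sep => i j /N_ad/(finite_heightP htP)[n ijn].
have [t Nt tn] := N_node i n; exists (hit t); split=> //.
  exact: open_subbase.
by move=> Njt; have := ijn t (conj Nt Njt); rewrite tn ltnn.
Qed.

Lemma hit_Gdelta_diagonal : Gdelta_diagonal (subbase_space hit).
Proof.
apply: (@Gdelta_intro (subbase_space hit * subbase_space hit)%type
    (fun n => \bigcup_(t in [set t | ht t = n]) (hit t `*` hit t))).
  by move=> n; apply: bigcup_open => t _; apply: open_square; exact: open_subbase.
move=> [i j]; split=> [ij n|ijn].
  have {}ij : i = j := ij.
  by rewrite -ij; have [t Nt tn] := N_node i n; exists t.
apply: contrapT => /N_ad/(finite_heightP htP)[n nP].
have [t /= tn [it jt]] := ijn n.
by have := nP t (conj it jt); rewrite tn ltnn.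
Qed.

Definition node_separable : Prop := exists D : set T,
  (forall i, G i -> infinite_set (D `&` N i)) /\
  (forall i, ~ G i -> finite_set (D `&` N i)).

(** The complement of [G] is the intersection of decreasing open sets [F n], and
    with [g] bounding how high one must look, every [N i] with [i] outside [G]
    avoids, for almost all [n], some finite [a] below height [g n] such that
    all trees avoiding [a] are in [F n].  On the other hand, when [i] is in [G]
    and not in [F n], the chain [N i] meets all such [a], hence so does the set
    of predecessors of one of its nodes.  It is here that chains are needed: the
    nodes at which a wider tree meets the different [a] need not lie below one
    node. *)
Lemma avoid_separable : Q_space (subbase_space avoid) -> node_separable.
Proof.
move=> /(_ (~` G))/Gdelta_decreasing[F [Fo F_decr FE]].
pose low n h := [set a | (forall t, a t -> ht t < h) /\
  subbasic_box avoid a `<=` F n].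
have /choice[f fP] : forall i, exists f : nat -> nat, forall n, ~ G i ->
    exists2 a, low n (f n) a & subbasic_box avoid a i.
  move=> i; suff /choice[f] : forall n, exists h, ~ G i ->
      exists2 a, low n h a & subbasic_box avoid a i by exists f.
  move=> n.
  have [Gi|NGi] := pselect (G i); first by exists 0.
  have /subbase_spaceE/(_ i)[|a [/(finite_heightP htP)[h ah] ai aF]] := Fo n.
    by have /FE := NGi.
  by exists h => _; exists a.
have [g gP] := bound f.
exists [set t | exists n, ht t = n + g n /\
  forall a, low n (g n) a -> exists2 u, a u & (u <= t)%O]; split=> i Gi.
  apply/(infinite_heightP htP) => n.
  have /existsNP[m NFm] : ~ forall n, F n i by move=> /FE.
  pose k := maxn m n.
  have NFk : ~ F k i by move=> /(F_decr _ _ (leq_maxl m n)).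
  have [_ _ chain] := N_branch Gi; have [t Nt tk] := N_node i (k + g k).
  exists t; last by rewrite tk (leq_trans (leq_maxr m n)) // leq_addr.
  split=> //; exists k; split=> // a [ag aF].
  have /existsNP[u /not_implyP[au /contrapT Nu]] : ~ subbasic_box avoid a i.
    by move=> /aF.
  exists u => //; apply: chain => //.
  by rewrite tk ltnW // (leq_trans (ag u au)) // leq_addl.
apply/(finite_heightP htP); have [m mP] := gP i.
exists (\max_(k < m) (k + g k)).+1 => t [[n [tn tP]] Nt].
rewrite ltnS tn; apply: (leq_bigmax_lt (fun k => k + g k)).
rewrite ltnNge; apply/negP => mn.
have [a [af aF] ai] := fP i n Gi.
have [|u au ut] := tP a; last by apply: (ai u au); exact: N_dc ut Nt.
by split=> // u au; exact: leq_trans (af u au) (mP n mn).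
Qed.

(** [G] is the intersection of decreasing open sets [F n].  When [i] is in [G],
    the finitely many nodes that put [N i] into a basic open subset of [F n] lie
    on a chain, so a single node [t] of [N i] suffices: all trees containing [t]
    are in [F n].  With [g] bounding the height of [t], collect these nodes. *)
Lemma hit_separable : Q_space (subbase_space hit) -> node_separable.
Proof.
move=> /(_ G)/Gdelta_decreasing[F [Fo F_decr FE]].
have /choice[f fP] : forall i, exists f : nat -> nat, forall n, G i ->
    exists t, [/\ N i t, n <= ht t, ht t <= f n & hit t `<=` F n].
  move=> i; suff /choice[f] : forall n, exists h, G i ->
      exists t, [/\ N i t, n <= ht t, ht t <= h & hit t `<=` F n] by exists f.
  move=> n.
  have [Gi|NGi] := pselect (G i); last by exists 0.
  have /subbase_spaceE/(_ i)[|a [/(finite_heightP htP)[h ah] ai aF]] := Fo n.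
    exact: (FE i).1.
  have [t Nt tnh] := N_node i (n + h); exists (n + h) => _; exists t.
  rewrite tnh; split=> //; first exact: leq_addr.
  have [_ _ chain] := N_branch Gi.
  move=> j Njt; apply: aF => u au; apply: N_dc Njt; apply: chain => //.
    exact: ai.
  by rewrite tnh ltnW // (leq_trans (ah u au)) // leq_addl.
have [g gP] := bound f.
exists [set t | exists n, [/\ n <= ht t, ht t <= g n & hit t `<=` F n]].
split=> i Gi.
  apply/(infinite_heightP htP) => n; have [m mP] := gP i.
  have [t [Nt nt tf tF]] := fP i (maxn m n) Gi.
  exists t; last by rewrite (leq_trans _ nt) // leq_maxr.
  split=> //; exists (maxn m n); split=> //.
  by rewrite (leq_trans tf) // mP // leq_maxl.
have /existsNP[m NFm] : ~ forall n, F n i by move=> /FE.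
apply/(finite_heightP htP); exists (\max_(k < m) g k).+1 => t [[n [_ tg tF]] Nt].
rewrite ltnS (leq_trans tg) //; apply: leq_bigmax_lt.
by rewrite ltnNge; apply/negP => /F_decr Fm; apply/NFm/Fm/tF.
Qed.

End NodeSpaces.

(** To separate [G] from the rest of [F] it is enough to separate one branch of
    each member of [G] from the other members of [F]. *)
Lemma at_witness_thin (K : Type) : at_witness K ->
  exists (d : Order.disp_t) (T : porderType d) (ht : T -> nat) (I : Type)
      (N : I -> set T) (G : set I),
    [/\ height_function ht, [set: I] #<= [set: K],
        (forall i, down_closed (N i)) /\ (forall i, infinite_set (N i)),
        (forall i j, i <> j -> finite_set (N i `&` N j))
      & (forall i, G i -> branch ht (N i)) /\ ~ node_separable N G].
Proof.
move=> [d [T [F [H [oT FS ad FK [HF NH]]]]]].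
have [ht htP] := omega_tree_height oT.
pose I := set_type F; pose G : set I := [set i | H (val i)].
have FI (i : I) : F (val i) by apply: set_mem; exact: valP.
have /choice[N NP] : forall i : I, exists N : set T,
    [/\ down_closed N, infinite_set N, N `<=` val i, (G i -> branch ht N)
      & (~ G i -> N = val i)].
  move=> i; have [iS iinf] := FS _ (FI i).
  have [Gi|NGi] := pselect (G i); last by exists (val i); split=> //; case: iS.
  by have [B [Bdc Binf Bch] Bi] := koenig htP iS iinf; exists B.
exists d, T, ht, I, N, G; split=> //.
- by rewrite (card_le_eql (card_setT _)).
- by split=> i; have [] := NP i.
- move=> i j ij; have [_ _ Ni _ _] := NP i; have [_ _ Nj _ _] := NP j.
  apply: (@sub_finite_set _ _ (val i `&` val j)); first exact: setISS.
  by apply: ad => // /val_inj.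
split=> [i|[D [DG DNG]]]; first by have [] := NP i.
apply: NH; exists D; split=> Y HY.
  have FY := HF _ HY; have /DG : G (SigSub (mem_set FY)) by [].
  have [_ _ NY _ _] := NP (SigSub (mem_set FY)).
  by apply: sub_infinite_set; exact: setIS.
have [FY NHY] := HY; have NGY : ~ G (SigSub (mem_set FY)) by [].
by have := DNG _ NGY; have [_ _ _ _ ->] := NP (SigSub (mem_set FY)).
Qed.

Definition q2_witness (K : Type) : Prop :=
  exists X : topologicalType,
    [/\ @second_countable X, hausdorff_space X, ~ Q_space X
      & [set: X] #= [set: K]].

Definition q1Delta_witness (K : Type) : Prop :=
  exists X : topologicalType,
    [/\ @second_countable X, accessible_space X, Gdelta_diagonal X,
        ~ Q_space X & [set: X] #= [set: K]].

(** A set of nodes separating the thinned family exists as soon as the spaces of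
    size at most [K] are Q-spaces, including the subspaces of the Cantor space
    that provide the dominating function. *)
Lemma at_witness_q2 (K : Type) : at_witness K ->
  exists2 L, q2_witness L & [set: L] #<= [set: K].
Proof.
move=> atK; apply: contrapT => none.
have Qs (X : topologicalType) : @second_countable X -> hausdorff_space X ->
    [set: X] #<= [set: K] -> Q_space X.
  move=> X2 Xh XK; apply: contrapT => NQ; apply: none; exists X => //.
  by exists X; split=> //; exact: card_eqxx.
have boundK : bounding K.
  apply/gaps_bounded_bounding/Q_space_gaps => Z pt pt_inj ZK.
  by apply: Qs => //; [exact: cantor_second_countable|exact: cantor_hausdorff].
have [d [T [ht [I [N [G [htP IK [Ndc Ninf] Nad [Nbr]]]]]]]] := at_witness_thin atK.
apply; apply: (avoid_separable htP) => // [f|]; first exact: boundK.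
apply: Qs => //; first exact: (avoid_second_countable htP).
exact: (avoid_hausdorff htP).
Qed.

Lemma at_witness_q1Delta (K : Type) : at_witness K ->
  exists2 L, q1Delta_witness L & [set: L] #<= [set: K].
Proof.
move=> atK; apply: contrapT => none.
have Qs (X : topologicalType) : @second_countable X -> accessible_space X ->
    Gdelta_diagonal X -> [set: X] #<= [set: K] -> Q_space X.
  move=> X2 Xa Xd XK; apply: contrapT => NQ; apply: none; exists X => //.
  by exists X; split=> //; exact: card_eqxx.
have boundK : bounding K.
  apply/gaps_bounded_bounding/Q_space_gaps => Z pt pt_inj ZK.
  apply: Qs => //; first exact: cantor_second_countable.
    exact/hausdorff_accessible/cantor_hausdorff.
  exact: cantor_Gdelta_diagonal.
have [d [T [ht [I [N [G [htP IK [Ndc Ninf] Nad [Nbr]]]]]]]] := at_witness_thin atK.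
apply; apply: (hit_separable htP) => // [f|]; first exact: boundK.
apply: Qs => //; first exact: (hit_second_countable htP).
  exact: (hit_accessible htP).
exact: (hit_Gdelta_diagonal htP).
Qed.

(** * From trees to spaces *)

Lemma open_forall_lt (X : topologicalType) (F : nat -> set X) n :
  (forall i, i < n -> open (F i)) -> open [set x | forall i, i < n -> F i x].
Proof.
move=> Fo; apply: open_pointwise => x Fx.
exists [set y | forall i, i < n -> F i y]; split=> //.
elim: n Fo {Fx} => [|n IH] Fo.
  by rewrite [X in open X](_ : _ = setT); [exact: openT|exact/seteqP].
rewrite [X in open X](_ : _ = [set y | forall i, i < n -> F i y] `&` F n).
  apply: openI; last exact: Fo.
  by apply: IH => i ilt; apply: Fo; rewrite ltnW.
apply/seteqP; split=> y /=.
  by move=> Fy; split=> [i ilt|]; apply: Fy => //; rewrite ltnW.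
move=> [Fy Fny] i; rewrite ltnS leq_eqVlt => /predU1P[->//|]; exact: Fy.
Qed.

Lemma separable_bounding (K : Type) : separable K -> bounding K.
Proof. by move=> /separable_gaps/gaps_bounded_bounding. Qed.

Section HausdorffSpaces.
Context {X : topologicalType} (V W : nat -> set X).
Hypothesis V_open : forall n, open (V n).
Hypothesis W_open : forall n, open (W n).
Hypothesis VW : forall n x, V n x -> ~ W n x.

(** The nodes of the tree of [x] are the possible guesses, for finitely many
    [n], of which of the disjoint sets [V n] and [W n] does not contain [x]. *)
Definition guesses (x : X) : set binary :=
  [set s | forall n, n < size s -> if nth false s n then ~ V n x else ~ W n x].

Lemma guesses_prefix x s t : prefix s t -> guesses x t -> guesses x s.
Proof.
move=> /prefixP[r ->] xs n ns; have := xs n.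
by rewrite nth_cat ns size_cat; apply; rewrite ltn_addr.
Qed.

Lemma guesses_infinite x n : exists2 s, guesses x s & n <= size s.
Proof.
exists (mkseq (fun k => `[< W k x >]) n); last by rewrite size_mkseq.
move=> k; rewrite size_mkseq => kn; rewrite nth_mkseq //.
by case: asboolP => [Wx Vx|//]; exact: VW Vx Wx.
Qed.

Lemma guesses_apart n x y s :
  V n x -> W n y -> guesses x s -> guesses y s -> size s <= n.
Proof.
move=> Vx Wy xs ys; rewrite leqNgt; apply/negP => ns.
by have := xs n ns; have := ys n ns; case: nth.
Qed.

Lemma open_not_guesses s : open [set x | ~ guesses x s].
Proof.
apply: open_pointwise => x /existsNP[n /not_implyP[ns xs]].
exists (if nth false s n then V n else W n); split.
- by case: nth.
- by move: xs; case: nth => /contrapT.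
- by move=> y; case sn: (nth false s n) => Uy ys; have := ys n ns; rewrite sn.
Qed.

End HausdorffSpaces.

Lemma hausdorff_pairs (X : topologicalType) :
  @second_countable X -> hausdorff_space X ->
  exists V W : nat -> set X, [/\ forall n, open (V n), forall n, open (W n),
    forall n x, V n x -> ~ W n x & forall x y, x <> y -> exists n, V n x /\ W n y].
Proof.
move=> /second_countable_basis[B [Bo Bb]] /hausdorff_sep sep.
pose pair n := odflt (0, 0) (choice.unpickle n : option (nat * nat)).
pose disj n := `[< forall x, B (pair n).1 x -> ~ B (pair n).2 x >].
exists (fun n => if disj n then B (pair n).1 else set0).
exists (fun n => if disj n then B (pair n).2 else set0); split.
- by move=> n; case: disj => //; exact: open0.
- by move=> n; case: disj => //; exact: open0.
- by move=> n x; rewrite /disj; case: asboolP => // dj; exact: dj.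
move=> x y /sep[U [W [Uo Wo Ux Wy UW]]].
have [p [px pU]] := Bb U x Uo Ux; have [q [qy qW]] := Bb W y Wo Wy.
exists (choice.pickle (p, q)); have pq : pair (choice.pickle (p, q)) = (p, q).
  by rewrite /pair choice.pickleK.
rewrite /disj pq; case: asboolP => //= -[] z /pU/UW + /qW; exact.
Qed.

(** Let [D] separate the trees of the points outside [A] from those of the
    points of [A].  The points whose trees miss a given finite part of [D] form an
    open set.  Let [O n] be this open set for the part of [D] between the levels
    [n] and [g n], where [g] dominates the heights of the next nodes in [D].  Then
    a point of [A] belongs to almost all [O n], and a point outside [A] to only
    finitely many. *)
Lemma separable_hausdorff (K : Type) (X : topologicalType) : separable K ->
  @second_countable X -> hausdorff_space X -> [set: X] #<= [set: K] ->
  Q_space X.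
Proof.
move=> sep X2 Xh XK A.
have [V [W [Vo Wo VW sepVW]]] := hausdorff_pairs X2 Xh.
pose S := guesses V W.
have [|||D [DNA DA]] := sep X S (~` A) XK.
- exact: guesses_prefix.
- exact: guesses_infinite.
- move=> x y /sepVW[n [Vx Wy]]; exists n.+1 => s xs ys.
  exact: guesses_apart Vx Wy xs ys.
have /choice[f fP] : forall x, exists f : nat -> nat, forall n, ~ A x ->
    exists s, [/\ D s, S x s, n <= size s & size s <= f n].
  move=> x; suff /choice[f] : forall n, exists h, ~ A x ->
    exists s, [/\ D s, S x s, n <= size s & size s <= h] by exists f.
  move=> n; have [Ax|NAx] := pselect (A x); first by exists 0.
  by have [s [Ds xs ns]] := DNA x NAx n; exists (size s) => _; exists s.
have [g gP] := separable_bounding sep f XK.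
pose O n := [set x | forall s, D s -> n <= size s <= g n -> ~ S x s].
have O_open n : open (O n).
  have /finite_seqP[l lP] : finite_set [set s : binary | size s < (g n).+1].
    by have [fin _ _ _] := binary_height; exact: fin.
  rewrite (_ : O n = [set x | forall i, i < size l ->
      [set x | D (nth [::] l i) -> n <= size (nth [::] l i) -> ~ S x (nth [::] l i)] x]).
    apply: open_forall_lt => i _.
    have [Di|NDi] := pselect (D (nth [::] l i)); last first.
      rewrite [X in open X](_ : _ = setT); first exact: openT.
      by apply/seteqP; split=> // x _ /NDi.
    have [ni|ni] := boolP (n <= size (nth [::] l i)); last first.
      rewrite [X in open X](_ : _ = setT); first exact: openT.
      by apply/seteqP; split=> // x _ _; rewrite (negbTE ni).
    rewrite [X in open X](_ : _ = [set x | ~ S x (nth [::] l i)]).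
      exact: open_not_guesses.
    by apply/seteqP; split=> x /= H; [exact: H|].
  have lE s : (s \in l) = (size s <= g n).
    by apply/idP/idP => [sl|sg]; have /seteqP[sub sup] := lP;
       [exact: sup|exact: sub].
  apply/seteqP; split=> x /= Ox.
    by move=> i /(mem_nth [::]); rewrite lE => ig Di ni; apply: Ox => //; rewrite ni.
  move=> s Ds /andP[ns]; rewrite -lE => /nthP-/(_ [::])[i il si].
  by have := Ox i il; rewrite si; exact.
apply: (@Gdelta_intro _ (fun n => \bigcup_(k in [set k | n <= k]) O k)).
  by move=> n; exact: bigcup_open.
move=> x; split=> [Ax n|Ox].
  have [|m mP] := DA x; first exact.
  exists (maxn m n) => [|s Ds /andP[ms _] xs]; first by rewrite /= leq_maxr.
  by have := mP s Ds xs; rewrite ltnNge (leq_trans _ ms) // leq_maxl.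
apply: contrapT => NAx; have [m mP] := gP x; have [n /= mn On] := Ox m.
have [s [Ds xs ns sf]] := fP x n NAx; apply: (On s Ds) xs.
by rewrite ns (leq_trans sf) // mP.
Qed.

Section GdeltaDiagonal.
Context {X : topologicalType} (B : nat -> set X) (in_cover : nat -> set nat).
Hypothesis B_open : forall p, open (B p).

(** Sets of indices of basic neighbourhoods of [x], given by their
    characteristic functions, which for every [n >= k] contain the index of a
    set of the [n]-th cover that is at most [g n]. *)
Definition neighbourhoods (g : nat -> nat) (k : nat) (x : X) : set binary :=
  [set s | (forall p, p < size s -> nth false s p -> B p x) /\
    forall n, k <= n -> g n < size s ->
      exists p, [/\ p <= g n, nth false s p & in_cover n p]].

Definition covered (g : nat -> nat) (k : nat) : set X :=
  [set x | forall n, k <= n -> exists p, [/\ p <= g n, B p x & in_cover n p]].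

Lemma neighbourhoods_prefix g k x s t :
  prefix s t -> neighbourhoods g k x t -> neighbourhoods g k x s.
Proof.
move=> /prefixP[r ->] [tB tn]; split=> [p ps sp|n kn gs].
  by apply: tB; rewrite ?size_cat ?ltn_addr // nth_cat ps.
have [|p [pg sp np]] := tn n kn; first by rewrite size_cat ltn_addr.
by exists p; split=> //; move: sp; rewrite nth_cat (leq_ltn_trans pg gs).
Qed.

Lemma neighbourhoods_infinite g k x n :
  covered g k x -> exists2 s, neighbourhoods g k x s & n <= size s.
Proof.
move=> cov; exists (mkseq (fun p => `[< B p x >]) n); last by rewrite size_mkseq.
split=> [p|m km]; rewrite size_mkseq => pn; first by rewrite nth_mkseq // => /asboolP.
have [p [pg px mp]] := cov m km; exists p; split=> //.
by rewrite nth_mkseq; [exact/asboolP|exact: leq_ltn_trans pn].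
Qed.

Lemma neighbourhoods_bounded g k x :
  ~ covered g k x -> exists n, forall s, neighbourhoods g k x s -> size s < n.
Proof.
move=> /existsNP[n /not_implyP[kn ncov]]; exists (g n).+1 => s [sB sn].
rewrite ltnS leqNgt; apply/negP => gs; apply: ncov.
have [p [pg sp np]] := sn n kn gs; exists p; split=> //.
by apply: sB => //; exact: leq_ltn_trans gs.
Qed.

Lemma open_neighbourhoods g k s : open [set x | neighbourhoods g k x s].
Proof.
apply: open_pointwise => x [xs sn].
exists [set y | forall p, p < size s -> (nth false s p -> B p y)]; split=> //.
apply: (@open_forall_lt _ (fun p => [set y | nth false s p -> B p y])) => p _.
case: (nth false s p); last first.
  by rewrite [X in open X](_ : _ = setT); [exact: openT|exact/seteqP].
rewrite [X in open X](_ : _ = B p) //.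
by apply/seteqP; split=> y /= H; [exact: H|].
Qed.

End GdeltaDiagonal.

(** Let the [n]-th cover consist of the basic open sets whose squares lie in the
    [n]-th neighbourhood of the diagonal.  Two points that have a node of length
    greater than [g n] in common have a common neighbourhood in this cover, so
    the trees of distinct points are almost disjoint; and a node belongs to the
    trees of an open set of points.  With [g] bounding the indices needed to
    cover the points, each point has an infinite tree from some [k] on.  For each
    [k] let [D k] separate the trees of the points in [A] from the others.
    Those others meet [D k] in finitely many nodes for every [k], whether or not
    their [k]-th trees are infinite, so with [r k] bounding the heights of these
    nodes the parts of the [D k] above height [r k] can be united. *)
Lemma separable_Gdelta_diagonal (K : Type) (X : topologicalType) :
  separable K -> @second_countable X -> Gdelta_diagonal X ->
  [set: X] #<= [set: K] -> Q_space X.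
Proof.
move=> sep /second_countable_basis[B [Bo Bb]].
move=> /Gdelta_decreasing[O [Oo O_decr OE]] XK A.
pose in_cover n p := B p `*` B p `<=` O n.
have /choice[f fP] : forall x, exists f : nat -> nat, forall n,
    B (f n) x /\ in_cover n (f n).
  move=> x; suff /choice[f] : forall n, exists p, B p x /\ in_cover n p by exists f.
  move=> n; have [|U [Uo Ux UO]] := @open_square_sub _ (O n) x (Oo n).
    exact: (OE (x, x)).1.
  have [p [px pU]] := Bb U x Uo Ux; exists p; split=> // -[y z] [/= py pz].
  by apply: UO; split; exact: pU.
have [g gP] := separable_bounding sep f XK.
have x_covered x : exists k, covered B in_cover g k x.
  have [m mP] := gP x; exists m => n mn; exists (f x n).
  by have [? ?] := fP x n; split=> //; exact: mP.
pose S k := neighbourhoods B in_cover g k.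
have /choice[D DP] : forall k, exists D : set binary,
    (forall x, covered B in_cover g k x -> A x ->
      forall n, exists s, [/\ D s, S k x s & n <= size s]) /\
    (forall x, ~ A x -> exists n, forall s, D s -> S k x s -> size s < n).
  move=> k; pose Y := set_type (covered B in_cover g k).
  have cov (y : Y) : covered B in_cover g k (val y) by apply: set_mem; exact: valP.
  have [||||D [DA DNA]] := sep Y (fun y => S k (val y)) [set y | A (val y)].
  - rewrite (card_le_eql (card_setT _)); exact: card_le_trans (card_leT _) XK.
  - by move=> y; exact: neighbourhoods_prefix.
  - by move=> y n; exact: neighbourhoods_infinite.
  - move=> y z yz; have /existsNP[n NO] : ~ forall n, O n (val y, val z).
      by move=> /OE /= /val_inj.
    exists (g (maxn n k)).+1 => s [ys sn] [zs _]; rewrite ltnS leqNgt.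
    apply/negP => gs; have [p [pg sp np]] := sn _ (leq_maxr n k) gs.
    have ps := leq_ltn_trans pg gs.
    apply/NO/(O_decr _ _ (leq_maxl n k))/np; split => /=.
      exact: ys.
    exact: zs.
  exists D; split=> x.
    move=> xk Ax n; exact: (DA (SigSub (mem_set xk)) Ax n).
  move=> NAx; have [xk|/neighbourhoods_bounded[n nP]] := pselect (covered B in_cover g k x).
    exact: (DNA (SigSub (mem_set xk)) NAx).
  by exists n => s _ /nP.
have /choice[h hP] : forall x, exists h : nat -> nat, forall k, ~ A x ->
    forall s, D k s -> S k x s -> size s < h k.
  move=> x; suff /choice[h] : forall k, exists n, ~ A x ->
    forall s, D k s -> S k x s -> size s < n by exists h.
  move=> k; have [Ax|NAx] := pselect (A x); first by exists 0.
  by have [n nP] := (DP k).2 x NAx; exists n.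
have [r rP] := separable_bounding sep h XK.
pose M n := [set ks : nat * binary |
  [/\ D ks.1 ks.2, n <= size ks.2 & r ks.1 <= size ks.2]].
apply: (@Gdelta_intro _
    (fun n => \bigcup_(ks in M n) [set x | S ks.1 x ks.2])).
  by move=> n; apply: bigcup_open => ks _; exact: open_neighbourhoods.
move=> x; split=> [Ax n|xM].
  have [k xk] := x_covered x.
  have [s [Ds xs]] := (DP k).1 x xk Ax (maxn n (r k)).
  by rewrite geq_max => /andP[ns rs]; exists (k, s).
apply: contrapT => NAx; have [m mP] := rP x.
have [[k s] [/= Ds ns rs] xs] := xM (\max_(k < m) h x k).
have sh := hP x k NAx s Ds xs.
have [km|mk] := ltnP k m.
  by move: (leq_trans (leq_bigmax_lt (h x) km) ns); rewrite leqNgt sh.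
by move: (leq_trans (mP k mk) rs); rewrite leqNgt sh.
Qed.

(** * The three cardinals *)

Lemma q2_witness_at (K : Type) : q2_witness K -> at_witness K.
Proof.
move=> [X [X2 Xh NQ XK]]; apply: contrapT => /not_at_witness sep; apply: NQ.
apply: separable_hausdorff sep X2 Xh _.
by rewrite (card_le_eql XK).
Qed.

Lemma q1Delta_witness_at (K : Type) : q1Delta_witness K -> at_witness K.
Proof.
move=> [X [X2 _ Xd NQ XK]]; apply: contrapT => /not_at_witness sep; apply: NQ.
apply: separable_Gdelta_diagonal sep X2 Xd _.
by rewrite (card_le_eql XK).
Qed.

Lemma least_cardinal_transfer (P Q : Type -> Prop) (K : Type) :
  least_cardinal P K ->
  (forall L, P L -> exists2 M, Q M & [set: M] #<= [set: L]) ->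
  (forall L, Q L -> P L) ->
  (forall L M, Q L -> [set: L] #= [set: M] -> Q M) ->
  least_cardinal Q K.
Proof.
move=> [PK Kmin] PQ QP Qeq; split=> [|L /QP]; last exact: Kmin.
have [M QM MK] := PQ K PK; apply: (Qeq M) => //.
by rewrite card_eq_le MK; apply/Kmin/QP.
Qed.

Theorem theorem17 : exists K : Type, [/\ is_q1Delta K, is_at K & is_q2 K].
Proof.
have [K0 atK0] := at_witness_exists.
have [K Kat] := least_cardinal_exists at_witness_card_le atK0.
exists K; split=> //.
- apply: least_cardinal_transfer Kat at_witness_q1Delta q1Delta_witness_at _.
  by move=> L M [X [? ? ? ? XL]] LM; exists X; split=> //; exact: card_eq_trans LM.
- apply: least_cardinal_transfer Kat at_witness_q2 q2_witness_at _.
  by move=> L M [X [? ? ? XL]] LM; exists X; split=> //; exact: card_eq_trans LM.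
Qed.
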